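(* For integers $0\le k\le n$ let \[T(n,k)=\sum_{\substack{0\le j\le n-k\\ 2\mid j}}\binom{k}{j}\binom{n-k}{j},\] and for $n\ge 0$ let \[d(n)=\sum_{k=0}^{\lfloor n/2\rfloor}\bigl(T(n-k,k)\bmod 2\bigr),\] where $x \bmod 2\in\{0,1\}$ denotes the least nonnegative residue. Let $n\ge 0$ be an integer and let $m=(m_0,\ldots,m_k)$ be the sequence of run lengths of the binary representation of $n$. Then $d(n)$ equals the continuant of $m$.
   Context: The binary representation of a positive integer $n$ is its base-$2$ digit string without leading zeros (so it begins with $1$); for $n=0$ it is the empty string. The run lengths of a string of $0$'s and $1$'s are the lengths of its maximal blocks of consecutive identical symbols, read from left to right (e.g. $111000011111$ has run lengths $(3,4,5)$). The continuant of a sequence $(m_0,\ldots,m_k)$ of positive integers is the numerator of the continued fraction $[m_0;m_1,\ldots,m_k]$; equivalently it is $K(m_0,\ldots,m_k)$ defined by $K()=1$, $K(m_0)=m_0$, and $K(m_0,\ldots,m_k)=m_kK(m_0,\ldots,m_{k-1})+K(m_0,\ldots,m_{k-2})$ for $k\ge1$ (so the continuant of the empty sequence is $1$). *)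

(* Defs.v *)
From Corelib Require Import BinNums.
From mathcomp Require Import all_boot.
Set Implicit Arguments.
Unset Strict Implicit.
Unset Printing Implicit Defensive.

(* Only meaningful for k <= n: otherwise n - k is truncated to 0. *)
Definition T (n k : nat) : nat :=
  \sum_(0 <= j < (n - k).+1 | 2 %| j) 'C(k, j) * 'C(n - k, j).

Definition d (n : nat) : nat :=
  \sum_(0 <= k < (n %/ 2).+1) (T (n - k) k %% 2).

(* Digits are booleans (true for 1), most significant first, whereas the
   constructors of positive have the least significant digit outermost. *)
Fixpoint pos_digits (p : positive) : seq bool :=
  match p with
  | xH => [:: true]
  | xO q => rcons (pos_digits q) false
  | xI q => rcons (pos_digits q) true
  end.

Definition binary (n : nat) : seq bool :=
  if bin_of_nat n is Npos p then pos_digits p else [::].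

Lemma binary_value (n : nat) :
  foldl (fun v (b : bool) => v.*2 + b) 0 (binary n) = n.
Proof.
rewrite -[RHS]bin_of_natK /binary; case: (bin_of_nat n) => //=.
by elim=> //= p IHp; rewrite foldl_rcons IHp NatTrec.doubleE ?addn1 ?addn0.
Qed.

Lemma binary_no_leading_zero (n : nat) : head true (binary n) = true.
Proof.
rewrite /binary; case: (bin_of_nat n) => //= p.
suff [s ->]: exists s, pos_digits p = true :: s by [].
by elim: p => /= [p [s ->]|p [s ->]|]; eexists.
Qed.

(* len counts the symbols of the current block of b's already read. *)
Fixpoint runs_from (b : bool) (len : nat) (s : seq bool) : seq nat :=
  if s is c :: s' then
    if c == b then runs_from b len.+1 s' else len :: runs_from c 1 s'
  else [:: len].

Definition run_lengths (s : seq bool) : seq nat :=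
  if s is b :: s' then runs_from b 1 s' else [::].

Example run_lengths_ex :
  run_lengths (nseq 3 true ++ nseq 4 false ++ nseq 5 true) = [:: 3; 4; 5].
Proof. by []. Qed.

(* The recurrence peels off the last entry, hence the reversal. *)
Fixpoint continuant_rev (s : seq nat) : nat :=
  match s with
  | [::] => 1
  | [:: m] => m
  | m :: ((_ :: s'') as s') => m * continuant_rev s' + continuant_rev s''
  end.

Definition continuant (s : seq nat) : nat := continuant_rev (rev s).

Lemma continuant_rcons2 (s : seq nat) (l m : nat) :
  continuant (rcons (rcons s l) m) = m * continuant (rcons s l) + continuant s.
Proof. by rewrite /continuant !rev_rcons. Qed.

(* Main.v *)
Require Import Defs.
From mathcomp Require Import all_boot.
Set Implicit Arguments.
Unset Strict Implicit.
Unset Printing Implicit Defensive.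

(** Modulo 2, Lucas' theorem and Vandermonde's identity turn [T (x + y) x] into
    ['C(x./2 + y./2, x./2)], and one more application of Lucas' theorem makes
    [d n] the number of odd binomial coefficients ['C(N - i, i)] with
    [N = n./2.*2].  That count is Stern's diatomic sequence (shifted by one), so
    the pair formed by the continuant of the runs of [n] and the continuant of
    all but the last run can be followed bit by bit: appending a bit maps
    [(p, q)] to [(p + q, q)] or [(p + q, p)], which is Stern's recurrence. *)

(** Lucas' theorem modulo 2 for the last binary digit, from Pascal's rule applied twice. The two
    parities of the lower entry share one induction, since the middle terms for one are the
    other. *)
Lemma odd_bin_double (a b : nat) :
  (odd 'C(a.*2, b.*2) = odd 'C(a, b)) * (odd 'C(a.*2, b.*2.+1) = false).
Proof.
elim: a b => [|a IH] [|b]; split; rewrite ?bin0 ?bin1 ?odd_double //.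
  by rewrite !doubleS !binS !oddD -doubleS !IH addbF addFb.
by rewrite [a.+1.*2]doubleS !binS !oddD !IH addbF addFb addbb.
Qed.

Lemma odd_bin_doubleS (a b : nat) :
  (odd 'C(a.*2.+1, b.*2) = odd 'C(a, b)) *
  (odd 'C(a.*2.+1, b.*2.+1) = odd 'C(a, b)).
Proof.
split; last by rewrite binS oddD !odd_bin_double.
case: b => [|b]; first by rewrite !bin0.
by rewrite doubleS binS oddD -doubleS !odd_bin_double addbF.
Qed.

Lemma odd_bin_half (a j : nat) : odd 'C(a, j.*2) = odd 'C(a./2, j).
Proof.
by rewrite -{1}(odd_double_half a); case: (odd a);
  rewrite ?add1n ?add0n (odd_bin_double, odd_bin_doubleS).
Qed.

Lemma eq_odd_sum (I : Type) (r : seq I) (P : pred I) (F G : I -> nat) :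
  (forall i, P i -> odd (F i) = odd (G i)) ->
  odd (\sum_(i <- r | P i) F i) = odd (\sum_(i <- r | P i) G i).
Proof.
by move=> FG; elim/big_ind2: _ => // x1 x2 y1 y2; rewrite !oddD => -> ->.
Qed.

Lemma sum_ord_double (m : nat) (F : nat -> nat) :
  \sum_(i < m.*2) F i = \sum_(i < m) (F i.*2 + F i.*2.+1).
Proof.
by elim: m => [|m IH]; rewrite ?big_ord0 // doubleS !big_ord_recr /= IH addnA.
Qed.

Lemma sum_ord_extend (m n : nat) (F : nat -> nat) :
    m <= n -> (forall i, m <= i -> F i = 0) ->
  \sum_(i < n) F i = \sum_(i < m) F i.
Proof.
move=> /subnKC <- F0; elim: (n - m) => [|k IH]; first by rewrite addn0.
by rewrite addnS big_ord_recr /= IH F0 ?leq_addr ?addn0.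
Qed.

Lemma sum_bin_mul_bin (x y m : nat) :
  y <= m -> \sum_(i < m.+1) 'C(x, i) * 'C(y, i) = 'C(x + y, x).
Proof.
move=> le_ym; have F0 k i : k < i -> 'C(k, i) = 0 by exact: bin_small.
(* Vandermonde's sum stops at [x], the given one at [m]; the range up to [x + m] covers both, and
   all added terms vanish. *)
transitivity (\sum_(i < (x + m).+1) 'C(x, i) * 'C(y, i)).
  symmetry; apply: (@sum_ord_extend _ _ (fun i => 'C(x, i) * 'C(y, i))) => [|i].
    by rewrite ltnS leq_addl.
  by move=> lt_mi; rewrite (F0 y) ?muln0 // (leq_ltn_trans le_ym).
rewrite (@sum_ord_extend x.+1 _ (fun i => 'C(x, i) * 'C(y, i))).
- rewrite [x + y]addnC -binomial.Vandermonde; apply: eq_bigr => i _.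
  by rewrite bin_sub -1?ltnS // mulnC.
- by rewrite ltnS leq_addr.
by move=> i lt_xi; rewrite F0.
Qed.

Lemma odd_T (n k : nat) : odd (T n k) = odd 'C(k./2 + (n - k)./2, k./2).
Proof.
rewrite /T; set y := n - k.
pose F j := if 2 %| j then 'C(k, j) * 'C(y, j) else 0.
have -> : \sum_(0 <= j < y.+1 | 2 %| j) 'C(k, j) * 'C(y, j) = \sum_(j < y.+1) F j.
  by rewrite big_mkcond big_mkord.
(* An even number of terms lets indices be paired as [i.*2] and [i.*2.+1]; [F] is zero on the
   latter. *)
rewrite -(@sum_ord_extend y.+1 y.+1.*2 F); first last.
- by move=> i lt_yi; rewrite /F (bin_small lt_yi) muln0 if_same.
- by rewrite -addnn leq_addr.
have le_half : y./2 <= y by rewrite leq_half_double -addnn -addnS leq_addr.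
rewrite -(sum_bin_mul_bin _ le_half) (sum_ord_double _ F); apply: eq_odd_sum => i _.
by rewrite /F !dvdn2 /= odd_double /= addn0 !oddM !odd_bin_half.
Qed.

(* [stern n] is the term of index [n + 1] of Stern's diatomic sequence. *)
Definition stern (n : nat) : nat := \sum_(i < n.+1) odd 'C(n - i, i).

Lemma stern_extend (n m : nat) :
  n < m -> \sum_(i < m) odd 'C(n - i, i) = stern n.
Proof.
move=> lt_nm; apply: (@sum_ord_extend _ _ (fun i => odd 'C(n - i, i) : nat)) => // i lt_ni.
by rewrite bin_small // (leq_ltn_trans (leq_subr _ _)).
Qed.

Lemma stern_doubleS (n : nat) : stern n.*2.+1 = stern n.
Proof.
rewrite {1}/stern -doubleS.
rewrite (sum_ord_double n.+1 (fun i => odd 'C(n.*2.+1 - i, i) : nat)).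
apply: eq_bigr => -[i /= le_in] _; rewrite ltnS in le_in.
by rewrite subSS subSn ?leq_double // -doubleB odd_bin_double odd_bin_doubleS addn0.
Qed.

Lemma stern_doubleSS (n : nat) : stern n.+1.*2 = stern n + stern n.+1.
Proof.
rewrite -(@stern_extend n.+1.*2 n.+2.*2) ?ltn_double //.
rewrite (sum_ord_double _ (fun i => odd 'C(n.+1.*2 - i, i) : nat)) big_split /=.
rewrite addnC; congr (_ + _); last first.
  by apply: eq_bigr => i _; rewrite -doubleB odd_bin_double.
rewrite -(@stern_extend n n.+2) //; apply: eq_bigr => -[i /=].
rewrite ltnS leq_eqVlt => /predU1P[-> _|le_in _].
  (* At the last index [i = n.+1] subtraction truncates to 0, and both sides are coefficients of the
     form ['C(0, _)] with positive lower entry. *)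
  have subnSn m : m - m.+1 = 0 by apply/eqP; exact: leqnSn.
  by rewrite !subnSn !bin0n.
rewrite ltnS in le_in.
by rewrite doubleS subSS subSn ?leq_double // -doubleB odd_bin_doubleS.
Qed.

(** With [N = n./2], the terms of [stern N.*2] beyond [N] vanish, and for [k <= N] Lucas reduces
    ['C(N.*2 - k, k)] to ['C(k./2 + (N - k), k./2)], the parity found in [odd_T]. *)
Lemma d_stern (n : nat) : d n = stern n./2.*2.
Proof.
rewrite /d divn2 big_mkord /stern; set N := n./2.
rewrite (@sum_ord_extend N.+1 N.*2.+1 (fun i => odd 'C(N.*2 - i, i) : nat)).
- apply: eq_bigr => -[k /=]; rewrite ltnS => le_kN _.
  rewrite modn2 odd_T; congr (nat_of_bool _).
  have -> : (n - k - k)./2 = N - k.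
    by rewrite -subnDA addnn -[n in n - _]odd_double_half -/N -addnBA ?leq_double //
      -doubleB half_bit_double.
  move: (odd k) (k./2) (odd_double_half k) => -[] j Ek.
    move: le_kN; rewrite -Ek add1n => le_kN.
    have lt_jN : j < N by apply: leq_trans le_kN; rewrite ltnS -addnn leq_addr.
    have -> : N.*2 - j.*2.+1 = (N - j.+1).*2.+1.
      by rewrite doubleB doubleS -subSn -?doubleS ?leq_double // doubleS subSS.
    by rewrite odd_bin_doubleS addnBA // -addnn -addnS subnDl.
  move: le_kN; rewrite -Ek add0n => le_kN.
  by rewrite -doubleB odd_bin_double addnBA // -addnn subnDl.
- by rewrite ltnS -addnn leq_addr.
move=> i lt_Ni; rewrite bin_small //.
by rewrite ltn_psubLR ?addnn ?ltn_double // (leq_ltn_trans _ lt_Ni).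
Qed.

(** Runs are read from the front, but the main induction appends digits at the end. *)
Lemma runs_from_rcons (b : bool) (l : nat) (s : seq bool) :
  exists u m, runs_from b l s = rcons u m /\
    forall c, runs_from b l (rcons s c) =
      if c == last b s then rcons u m.+1 else rcons (rcons u m) 1.
Proof.
elim: s b l => [|a s IH] b l /=; first by exists [::], l.
case: eqP => [->|_]; first exact: IH.
have [u [m [-> E]]] := IH a 1.
by exists (l :: u), m; split=> // c; rewrite E; case: eqP.
Qed.

Lemma continuant_rconsS (u : seq nat) (m : nat) :
  continuant (rcons u m.+1) = continuant (rcons u m) + continuant u.
Proof.
case/lastP: u => [|u l]; first by rewrite /continuant /= addn1.
by rewrite !continuant_rcons2 mulSn -addnA addnC.
Qed.

Lemma continuant_rcons1 (u : seq nat) (m : nat) :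
  continuant (rcons (rcons u m) 1) = continuant (rcons u m) + continuant u.
Proof. by rewrite continuant_rcons2 mul1n. Qed.

Definition bits_value (s : seq bool) : nat :=
  foldl (fun v (b : bool) => v.*2 + b) 0 s.

Lemma bits_value_rcons (s : seq bool) (c : bool) :
  bits_value (rcons s c) = c + (bits_value s).*2.
Proof. by rewrite /bits_value foldl_rcons addnC. Qed.

Lemma last_bits_value (s : seq bool) : last true s = odd (bits_value (true :: s)).
Proof.
case/lastP: s => // s c.
by rewrite last_rcons -rcons_cons bits_value_rcons oddD odd_double addbF oddb.
Qed.

Lemma bits_value_gt0 (s : seq bool) : 0 < bits_value (true :: s).
Proof.
elim/last_ind: s => // s c IH.
by rewrite -rcons_cons bits_value_rcons addn_gt0 double_gt0 IH orbT.
Qed.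

(** For the value [n.+1], the pair in the invariant below is [stern n] and [stern n.+1], ordered by
    the parity of [n]. *)
Lemma stern_half (n : nat) :
  (stern n.+1./2.*2 = stern (odd n + n)) *
  (stern (uphalf n.+1).-1 = stern (~~ odd n + n)).
Proof.
rewrite -[uphalf n.+1]/n./2.+1 -[n.+1./2]/(uphalf n) uphalf_half.
move: (odd n) (n./2) (odd_double_half n) => -[] m <-.
  by rewrite !add1n add0n stern_doubleS.
by rewrite !add0n add1n stern_doubleS.
Qed.

Lemma continuant_runs_stern (s : seq bool) (n := bits_value (true :: s)) :
  exists u m, [/\ run_lengths (true :: s) = rcons u m,
    continuant (rcons u m) = stern n./2.*2 & continuant u = stern (uphalf n).-1].
Proof.
rewrite {}/n; elim/last_ind: s => [|s c [u [m [Er Ep Eq]]]].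
  by exists [::], 1; rewrite /bits_value /stern /continuant !big_ord_recr !big_ord0.
have [u' [m' [Er' E]]] := runs_from_rcons true 1 s.
have [? ?] := rcons_inj (etrans (esym Er') Er).
subst u' m'; rewrite /= E last_bits_value -rcons_cons bits_value_rcons.
have := bits_value_gt0 s; move: Ep Eq; case: (bits_value _) => // n Ep Eq _.
rewrite half_bit_double uphalf_half half_bit_double oddD odd_double addbF oddb.
rewrite stern_doubleSS addnS; move: Ep Eq; rewrite !stern_half => Ep Eq.
(* The first component becomes the sum of the old pair for either [c]. The second becomes
   [stern (c + n)]: the old second component if [c] repeats the last digit [~~ odd n], the old first
   one otherwise. *)
case: eqP => [->|/eqP ne_c].
  exists u, m.+1; rewrite continuant_rconsS Ep Eq; split=> //.
  by case: (odd n); rewrite // addnC.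
exists (rcons u m), 1; rewrite continuant_rcons1 Ep Eq; split=> //.
  by case: (odd n); rewrite // addnC.
by move: ne_c => /=; case: c (odd n) => -[].
Qed.

Theorem theorem1 (n : nat) : d n = continuant (run_lengths (binary n)).
Proof.
rewrite d_stern -{1}(binary_value n); move: (binary_no_leading_zero n).
case: (binary n) => [_|b s b_true]; first by rewrite /stern big_ord_recr big_ord0.
rewrite (b_true : b = true).
by have [u [m [-> -> _]]] := continuant_runs_stern s.
Qed.
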